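(* Let $q\in(0,1)$ and let $n\ge 1$ be an integer. Then for every real $z>0$, $$\frac{q-q^{n+2}}{1-q^{n+2}}\,\bigl(\mathcal{I}_{n}(q;z)\bigr)^{2}\le\mathcal{I}_{n-1}(q;z)\,\mathcal{I}_{n+1}(q;z)<\bigl(\mathcal{I}_{n}(q;z)\bigr)^{2}.$$ Moreover, the constant $\frac{q-q^{n+2}}{1-q^{n+2}}$ is best possible in the left-hand inequality; that is, for fixed $q$ and $n$ it is the largest real number $c$ such that $c\,(\mathcal{I}_n(q;z))^2\le\mathcal{I}_{n-1}(q;z)\mathcal{I}_{n+1}(q;z)$ holds for all $z>0$.
   Context: For $q\in(0,1)$, the $q$-shifted factorials are $(q;q)_0=1$ and $(q;q)_n=\prod_{k=1}^{n}(1-q^{k})$ for $n\ge 1$. The $q$-exponential function $E(q;z)$ is defined for $z\in\mathbb{C}$ by $$E(q;z)=\sum_{k=0}^{\infty}q^{\frac{k(k-1)}{2}}\frac{z^{k}}{(q;q)_{k}}.$$ For an integer $n\ge 0$ and $z>0$, its remainder is $$\mathcal{I}_n(q;z)=E(q;z)-\sum_{k=0}^{n}q^{\frac{k(k-1)}{2}}\frac{z^{k}}{(q;q)_{k}}.$$ *)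

(* Defs.v *)
From Stdlib Require Import Reals.
From Coquelicot Require Import Coquelicot.

Open Scope R_scope.

(* (q;q)_n = (1 - q) (1 - q^2) ... (1 - q^n) *)
Fixpoint qfact (q : R) (n : nat) : R :=
  match n with
  | O => 1
  | S m => qfact q m * (1 - q ^ S m)
  end.

(* The exponent is computed in [nat]: the division is exact, and for k = 0 the
   truncated k - 1 is multiplied by 0. *)
Definition qexp_term (q z : R) (k : nat) : R :=
  q ^ (k * (k - 1) / 2)%nat * z ^ k / qfact q k.

(* E(q;z) at a real argument. For 0 < q < 1 the ratio of consecutive terms,
   q^k z / (1 - q^(k+1)), tends to 0, so the series converges absolutely and
   [Series] is its sum. *)
Definition qexp (q z : R) : R := Series (qexp_term q z).

(* [sum_f_R0 f n] has the n + 1 terms f 0, ..., f n. *)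
Definition qexp_rem (n : nat) (q z : R) : R :=
  qexp q z - sum_f_R0 (qexp_term q z) n.

(* Main.v *)
Require Import Defs.
From Stdlib Require Import Reals Lra Lia.
From Coquelicot Require Import Coquelicot.

Open Scope R_scope.

(** Let t_k be the k-th term of E(q;z) and r_k = t_(k+1) / t_k = q^k z / (1 - q^(k+1)).
    The remainder starting at t_m is t_m F_m with F_m = sum_j r_m ... r_(m+j-1), and
    t_n t_(n+2) / t_(n+1)^2 = r_(n+1) / r_n is exactly the constant of the theorem.
    So the left inequality says F_(n+1)^2 <= F_n F_(n+2): every summand of F_m is
    log-convex in m because r_m is, and log-convexity passes to sums (Cauchy-Schwarz).
    The right inequality amounts to F_(n+1) < F_n, which holds since r_m decreases.
    The constant is optimal since 1 <= F_m <= 1 / (1 - r_m) gives F_m -> 1 as z -> 0. *)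

(** * The ratios r_k, their products, and the terms of E(q;z) *)

Definition qratio (q z : R) (k : nat) : R := q ^ k * z / (1 - q ^ S k).

Fixpoint qratio_prod (q z : R) (m j : nat) : R :=
  match j with
  | O => 1
  | S i => qratio_prod q z m i * qratio q z (m + i)
  end.

Definition qtail (q z : R) (m : nat) : R := Series (qratio_prod q z m).

Lemma pow_S_lt_1 (q : R) (k : nat) : 0 < q < 1 -> q ^ S k < 1.
Proof. intros hq; apply pow_lt_1_compat; [lra | lia]. Qed.

Lemma qfact_pos (q : R) (k : nat) : 0 < q < 1 -> 0 < qfact q k.
Proof.
  intros hq; induction k as [|k IH]; [simpl; lra|].
  change (0 < qfact q k * (1 - q ^ S k)).
  pose proof (pow_S_lt_1 q k hq); apply Rmult_lt_0_compat; lra.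
Qed.

Lemma qexp_term_pos (q z : R) (k : nat) : 0 < q < 1 -> 0 < z -> 0 < qexp_term q z k.
Proof.
  intros hq hz; unfold qexp_term.
  apply Rdiv_lt_0_compat; [|now apply qfact_pos].
  apply Rmult_lt_0_compat; apply pow_lt; lra.
Qed.

Lemma qexp_term_S (q z : R) (k : nat) : 0 < q < 1 ->
  qexp_term q z (S k) = qexp_term q z k * qratio q z k.
Proof.
  intros hq; unfold qexp_term, qratio.
  assert (Hexp : (S k * (S k - 1) / 2 = k * (k - 1) / 2 + k)%nat).
  { replace (S k * (S k - 1))%nat with (k * (k - 1) + k * 2)%nat.
    - now rewrite Nat.div_add.
    - destruct k; [reflexivity|]. simpl (S (S k) - 1)%nat. simpl (S k - 1)%nat.
      rewrite Nat.sub_0_r. ring. }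
  rewrite Hexp, pow_add.
  change (qfact q (S k)) with (qfact q k * (1 - q ^ S k)).
  change (z ^ S k) with (z * z ^ k).
  pose proof (qfact_pos q k hq); pose proof (pow_S_lt_1 q k hq).
  field; split; lra.
Qed.

Lemma qratio_pos (q z : R) (k : nat) : 0 < q < 1 -> 0 < z -> 0 < qratio q z k.
Proof.
  intros hq hz; unfold qratio; pose proof (pow_S_lt_1 q k hq).
  apply Rdiv_lt_0_compat; [apply Rmult_lt_0_compat; [apply pow_lt|]; lra | lra].
Qed.

(** At k = n the factor is the constant of the theorem; being below 1, it also makes the ratios
    decrease. *)
Lemma qratio_S (q z : R) (k : nat) : 0 < q < 1 ->
  qratio q z (S k) = (q - q ^ (k + 2)) / (1 - q ^ (k + 2)) * qratio q z k.
Proof.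
  intros hq; unfold qratio.
  replace (k + 2)%nat with (S (S k)) by lia.
  pose proof (pow_S_lt_1 q k hq) as H1; pose proof (pow_S_lt_1 q (S k) hq) as H2.
  simpl in *; field; split; lra.
Qed.

Lemma qratio_decr (q z : R) (k : nat) : 0 < q < 1 -> 0 < z ->
  qratio q z (S k) < qratio q z k.
Proof.
  intros hq hz; rewrite qratio_S by assumption.
  pose proof (qratio_pos q z k hq hz).
  rewrite <- (Rmult_1_l (qratio q z k)) at 2.
  apply Rmult_lt_compat_r; [assumption|].
  replace (k + 2)%nat with (S (S k)) by lia.
  pose proof (pow_S_lt_1 q (S k) hq).
  apply Rlt_div_l; lra.
Qed.

Lemma qratio_log_convex (q z : R) (k : nat) : 0 < q < 1 -> 0 < z ->
  qratio q z (S k) ^ 2 <= qratio q z k * qratio q z (S (S k)).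
Proof.
  intros hq hz; unfold qratio.
  pose proof (pow_S_lt_1 q k hq) as H1; pose proof (pow_S_lt_1 q (S k) hq) as H2.
  pose proof (pow_S_lt_1 q (S (S k)) hq) as H3.
  assert (Hx : 0 < q ^ k) by (apply pow_lt; lra).
  simpl in *; set (x := q ^ k) in *.
  apply Rminus_le_0.
  (* With x = q^k, the numerator comes from (1 - q^2 x)^2 - (1 - q x)(1 - q^3 x) = q x (1 - q)^2. *)
  replace (_ - _) with
    ((q * x * z) ^ 2 * (q * x * (1 - q) ^ 2)
      / ((1 - q * x) * (1 - q * (q * x)) ^ 2 * (1 - q * (q * (q * x)))))
    by (field; repeat split; lra).
  apply Rdiv_le_0_compat.
  - apply Rmult_le_pos; [apply pow2_ge_0|].
    apply Rmult_le_pos; [nra | apply pow2_ge_0].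
  - apply Rmult_lt_0_compat; [apply Rmult_lt_0_compat|]; try lra.
    apply pow_lt; lra.
Qed.

(** * Products of ratios, convergence, and the factorization of the remainders *)

Lemma qratio_prod_pos (q z : R) (m j : nat) : 0 < q < 1 -> 0 < z ->
  0 < qratio_prod q z m j.
Proof.
  intros hq hz; induction j as [|j IH]; simpl; [lra|].
  apply Rmult_lt_0_compat; [assumption | now apply qratio_pos].
Qed.

(** The definition peels off the last factor; the recursion for the tails needs the first. *)
Lemma qratio_prod_shift (q z : R) (m j : nat) :
  qratio_prod q z m (S j) = qratio q z m * qratio_prod q z (S m) j.
Proof.
  induction j as [|j IH].
  - simpl; rewrite Nat.add_0_r; ring.
  - change (qratio_prod q z m (S (S j)))
      with (qratio_prod q z m (S j) * qratio q z (m + S j)).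
    rewrite IH, Nat.add_succ_r; simpl; ring.
Qed.

Lemma qexp_term_add (q z : R) (m j : nat) : 0 < q < 1 ->
  qexp_term q z (m + j) = qexp_term q z m * qratio_prod q z m j.
Proof.
  intros hq; induction j as [|j IH].
  - rewrite Nat.add_0_r; simpl; ring.
  - rewrite Nat.add_succ_r, qexp_term_S, IH by assumption; simpl; ring.
Qed.

Lemma qratio_lim (q z : R) : 0 < q < 1 -> 0 < z -> is_lim_seq (qratio q z) 0.
Proof.
  intros hq hz.
  (* The geometric majorant uses 1 - q^(k+1) >= 1 - q. *)
  apply is_lim_seq_le_le with (u := fun _ => 0) (w := fun k => q ^ k * (z / (1 - q))).
  - intros k; split; [left; now apply qratio_pos|].
    unfold qratio, Rdiv; rewrite Rmult_assoc.
    apply Rmult_le_compat_l; [apply pow_le; lra|].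
    apply Rmult_le_compat_l; [lra|].
    apply Rinv_le_contravar; [lra|].
    assert (q ^ k <= 1 ^ k) by (apply pow_incr; lra).
    rewrite pow1 in *; simpl; nra.
  - apply is_lim_seq_const.
  - replace (Finite 0) with (Rbar_mult 0 (z / (1 - q))) by (simpl; f_equal; ring).
    apply is_lim_seq_scal_r, is_lim_seq_geom; rewrite Rabs_pos_eq; lra.
Qed.

Lemma ex_series_qratio_prod (q z : R) (m : nat) : 0 < q < 1 -> 0 < z ->
  ex_series (qratio_prod q z m).
Proof.
  intros hq hz; apply ex_series_Rabs, ex_series_DAlembert with (k := 0); [lra| |].
  - intros j; pose proof (qratio_prod_pos q z m j hq hz); lra.
  - apply is_lim_seq_ext with (fun j => qratio q z (j + m)).
    + intros j; pose proof (qratio_prod_pos q z m j hq hz) as Hp; simpl.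
      rewrite (Nat.add_comm j m).
      replace (_ / _) with (qratio q z (m + j)) by (field; lra).
      symmetry; apply Rabs_pos_eq; left; now apply qratio_pos.
    + now apply (is_lim_seq_incr_n (qratio q z) m 0), qratio_lim.
Qed.

Lemma qexp_rem_qtail (q z : R) (n : nat) : 0 < q < 1 -> 0 < z ->
  qexp_rem n q z = qexp_term q z (S n) * qtail q z (S n).
Proof.
  intros hq hz; unfold qexp_rem, qexp, qtail.
  rewrite (Series_incr_n (qexp_term q z) (S n)); [|lia|].
  - rewrite <- Series_scal_l; simpl pred.
    rewrite (Series_ext (fun k => qexp_term q z (S n + k))
               (fun k => qexp_term q z (S n) * qratio_prod q z (S n) k))
      by (intros k; now apply qexp_term_add).
    ring.
  (* E(q;z) itself is the tail from index 0, so its convergence is the case m = 0. *)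
  - apply ex_series_ext with (fun j => qexp_term q z 0 * qratio_prod q z 0 j).
    + intros j; symmetry; exact (qexp_term_add q z 0 j hq).
    + apply (ex_series_scal_l (qexp_term q z 0) (qratio_prod q z 0)); now apply ex_series_qratio_prod.
Qed.

(** * Recursion and monotonicity of the tails F_m *)

Lemma qtail_rec (q z : R) (m : nat) : 0 < q < 1 -> 0 < z ->
  qtail q z m = 1 + qratio q z m * qtail q z (S m).
Proof.
  intros hq hz; unfold qtail.
  rewrite Series_incr_1 by now apply ex_series_qratio_prod.
  rewrite <- Series_scal_l; f_equal.
  apply Series_ext; intros j; apply qratio_prod_shift.
Qed.

Lemma Series_nonneg (a : nat -> R) : (forall k, 0 <= a k) -> ex_series a -> 0 <= Series a.
Proof.
  intros Ha Hex; rewrite <- (Rmult_0_l (Series a)), <- Series_scal_l.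
  apply Series_le; [|assumption].
  intros k; rewrite Rmult_0_l; split; [lra | apply Ha].
Qed.

Lemma qtail_ge_1 (q z : R) (m : nat) : 0 < q < 1 -> 0 < z -> 1 <= qtail q z m.
Proof.
  intros hq hz; unfold qtail.
  rewrite Series_incr_1 by now apply ex_series_qratio_prod.
  assert (H : 0 <= Series (fun j => qratio_prod q z m (S j))).
  { apply Series_nonneg.
    - intros j; left; now apply qratio_prod_pos.
    - apply (ex_series_incr_1 (qratio_prod q z m)); now apply ex_series_qratio_prod. }
  simpl qratio_prod at 1; lra.
Qed.

Lemma qratio_prod_decr (q z : R) (m j : nat) : 0 < q < 1 -> 0 < z ->
  qratio_prod q z (S m) j <= qratio_prod q z m j.
Proof.
  intros hq hz; induction j as [|j IH]; simpl; [lra|].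
  apply Rmult_le_compat; try assumption.
  - left; now apply qratio_prod_pos.
  - left; now apply (qratio_pos q z (S (m + j))).
  - left; now apply qratio_decr.
Qed.

Lemma qtail_decr_weak (q z : R) (m : nat) : 0 < q < 1 -> 0 < z ->
  qtail q z (S m) <= qtail q z m.
Proof.
  intros hq hz; apply Series_le; [|now apply ex_series_qratio_prod].
  intros j; split; [left; now apply qratio_prod_pos | now apply qratio_prod_decr].
Qed.

Lemma qtail_decr (q z : R) (m : nat) : 0 < q < 1 -> 0 < z ->
  qtail q z (S m) < qtail q z m.
Proof.
  intros hq hz.
  pose proof (qtail_rec q z m hq hz); pose proof (qtail_rec q z (S m) hq hz).
  pose proof (qtail_ge_1 q z (S m) hq hz).
  pose proof (qtail_decr_weak q z (S m) hq hz).
  pose proof (qratio_decr q z m hq hz).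
  pose proof (qratio_pos q z (S m) hq hz).
  (* F_m - F_(m+1) = r_m F_(m+1) - r_(m+1) F_(m+2), where r_m > r_(m+1) > 0 and F_(m+1) >= F_(m+2),
     F_(m+1) >= 1. *)
  nra.
Qed.

(** * Log-convexity of the tails *)

Lemma qratio_prod_log_convex (q z : R) (m j : nat) : 0 < q < 1 -> 0 < z ->
  qratio_prod q z (S m) j ^ 2 <= qratio_prod q z m j * qratio_prod q z (S (S m)) j.
Proof.
  intros hq hz; induction j as [|j IH]; [simpl; lra|].
  cbn [qratio_prod]; rewrite Rpow_mult_distr.
  replace (_ * _ * (_ * _)) with
    (qratio_prod q z m j * qratio_prod q z (S (S m)) j
      * (qratio q z (m + j) * qratio q z (S (S (m + j))))) by (simpl; ring).
  apply Rmult_le_compat; try apply pow2_ge_0; [assumption|].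
  now apply qratio_log_convex.
Qed.

Lemma Series_log_convex (a b c : nat -> R) :
  ex_series a -> ex_series b -> ex_series c ->
  (forall k, 0 < a k) -> (forall k, b k ^ 2 <= a k * c k) ->
  0 < Series a -> Series b ^ 2 <= Series a * Series c.
Proof.
  intros Ha Hb Hc Hpos Habc HA.
  set (l := Series b / Series a).
  (* The quadratic form l^2 a - 2 l b + c is nonnegative termwise, hence on sums;
     the chosen l minimizes it on sums. *)
  assert (Ha' : ex_series (fun k => l ^ 2 * a k)) by now apply (ex_series_scal_l (l ^ 2) a).
  assert (Hb' : ex_series (fun k => 2 * l * b k)) by now apply (ex_series_scal_l (2 * l) b).
  assert (Hac : ex_series (fun k => l ^ 2 * a k + c k))
    by now apply (ex_series_plus (fun k => l ^ 2 * a k) c).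
  assert (Hq : 0 <= Series (fun k => (l ^ 2 * a k + c k) - 2 * l * b k)).
  { apply Series_nonneg.
    (* Multiplied by a_k, the form becomes (l a_k - b_k)^2 + (a_k c_k - b_k^2). *)
    - intros k; apply (Rmult_le_reg_l (a k)); [apply Hpos|].
      pose proof (Habc k); pose proof (pow2_ge_0 (l * a k - b k)); nra.
    - now apply (ex_series_minus (fun k => l ^ 2 * a k + c k) (fun k => 2 * l * b k)). }
  rewrite Series_minus, Series_plus, !Series_scal_l in Hq by assumption.
  apply Rminus_le_0 in Hq.
  (* With A, B, C the three sums and l = B / A, multiplying by A gives 2 B^2 <= B^2 + A C. *)
  apply (Rmult_le_compat_l (Series a)) in Hq; [|lra].
  replace (Series a * (2 * l * Series b)) with (2 * Series b ^ 2) in Hq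
    by (unfold l; field; lra).
  replace (Series a * (l ^ 2 * Series a + Series c))
    with (Series b ^ 2 + Series a * Series c) in Hq by (unfold l; field; lra).
  lra.
Qed.

Lemma qtail_log_convex (q z : R) (m : nat) : 0 < q < 1 -> 0 < z ->
  qtail q z (S m) ^ 2 <= qtail q z m * qtail q z (S (S m)).
Proof.
  intros hq hz; apply Series_log_convex; try now apply ex_series_qratio_prod.
  - intros k; now apply qratio_prod_pos.
  - intros k; now apply qratio_prod_log_convex.
  - pose proof (qtail_ge_1 q z m hq hz); unfold qtail in *; lra.
Qed.

(** Since F_(m+1) < F_m, the recursion gives F_m <= 1 + r_m F_m. *)
Lemma qtail_le (q z : R) (m : nat) : 0 < q < 1 -> 0 < z -> qratio q z m < 1 ->
  qtail q z m * (1 - qratio q z m) <= 1.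
Proof.
  intros hq hz hr; rewrite (qtail_rec q z m) at 1 by assumption.
  pose proof (qtail_decr q z m hq hz) as Hd.
  rewrite (qtail_rec q z m) in Hd by assumption.
  pose proof (qratio_pos q z m hq hz).
  pose proof (qtail_ge_1 q z (S m) hq hz).
  nra.
Qed.

(** * The two inequalities and the optimality of the constant *)

Lemma qexp_rem_prod (q z : R) (n : nat) : 0 < q < 1 -> 0 < z -> (1 <= n)%nat ->
  qexp_rem (n - 1) q z * qexp_rem (n + 1) q z
  = qexp_term q z (S n) ^ 2 * ((q - q ^ (n + 2)) / (1 - q ^ (n + 2))
      * (qtail q z n * qtail q z (S (S n)))).
Proof.
  intros hq hz hn; rewrite !qexp_rem_qtail by assumption.
  replace (S (n - 1)) with n by lia; replace (S (n + 1)) with (S (S n)) by lia.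
  rewrite (qexp_term_S q z (S n)), (qexp_term_S q z n), qratio_S by assumption; ring.
Qed.

Theorem theorem2 (q : R) (n : nat) (hq : 0 < q < 1) (hn : (1 <= n)%nat) :
  (forall z : R, 0 < z ->
     (q - q ^ (n + 2)) / (1 - q ^ (n + 2)) * qexp_rem n q z ^ 2
       <= qexp_rem (n - 1) q z * qexp_rem (n + 1) q z
     /\ qexp_rem (n - 1) q z * qexp_rem (n + 1) q z < qexp_rem n q z ^ 2)
  /\
  (forall c : R,
     (forall z : R, 0 < z ->
        c * qexp_rem n q z ^ 2
          <= qexp_rem (n - 1) q z * qexp_rem (n + 1) q z) ->
     c <= (q - q ^ (n + 2)) / (1 - q ^ (n + 2))).
Proof.
  assert (Hc0 : 0 < (q - q ^ (n + 2)) / (1 - q ^ (n + 2))).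
  { replace (n + 2)%nat with (S (S n)) by lia.
    pose proof (pow_S_lt_1 q n hq); pose proof (pow_S_lt_1 q (S n) hq).
    apply Rdiv_lt_0_compat; [|lra]. change (q ^ S (S n)) with (q * q ^ S n); nra. }
  split.
  - intros z hz; split.
    + rewrite qexp_rem_prod, qexp_rem_qtail by assumption.
      rewrite Rpow_mult_distr, <- Rmult_assoc, (Rmult_comm (_ / _)), Rmult_assoc.
      apply Rmult_le_compat_l; [apply pow2_ge_0|].
      apply Rmult_le_compat_l; [lra|].
      now apply qtail_log_convex.
    + rewrite !qexp_rem_qtail by assumption.
      replace (S (n - 1)) with n by lia; replace (S (n + 1)) with (S (S n)) by lia.
      pose proof (qtail_decr q z n hq hz) as Hd.
      pose proof (qexp_term_pos q z n hq hz) as Ht.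
      pose proof (qratio_pos q z n hq hz) as Hr.
      pose proof (qtail_rec q z n hq hz) as E0.
      pose proof (qtail_rec q z (S n) hq hz) as E1.
      rewrite (qexp_term_S q z (S n)), (qexp_term_S q z n) by assumption.
      set (t := qexp_term q z n) in *; set (r := qratio q z n) in *.
      set (s := qratio q z (S n)) in *; set (F0 := qtail q z n) in *.
      set (F1 := qtail q z (S n)) in *; set (F2 := qtail q z (S (S n))) in *.
      apply Rminus_lt_0.
      (* The recursions r F1 = F0 - 1 and s F2 = F1 - 1 turn r F1^2 - s F0 F2 into F1 (F0 - 1) - F0
         (F1 - 1) = F0 - F1. *)
      replace (_ - _) with (t ^ 2 * r * (F0 - F1)).
      * apply Rmult_lt_0_compat; [|lra].
        apply Rmult_lt_0_compat; [apply pow_lt|]; assumption.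
      * replace (t * F0 * (t * r * s * F2)) with (t ^ 2 * r * (F0 * (s * F2))) by ring.
        replace (s * F2) with (F1 - 1) by lra.
        rewrite E0; ring.
  - intros c Hc; apply Rnot_lt_le; intros Hlt.
    set (c0 := (q - q ^ (n + 2)) / (1 - q ^ (n + 2))) in *.
    (* A value for r_n small enough that c (1 - e) > c0; the z below realizes r_n = e exactly. *)
    set (e := (c - c0) / (4 * c)).
    assert (He : c * e = (c - c0) / 4) by (unfold e; field; lra).
    assert (He0 : 0 < e) by (apply Rdiv_lt_0_compat; lra).
    assert (He1 : e < 1) by nra.
    pose proof (pow_S_lt_1 q n hq) as Hq1.
    assert (Hqn : 0 < q ^ n) by (apply pow_lt; lra).
    set (z := e * (1 - q ^ S n) / q ^ n).
    assert (hz : 0 < z) by (apply Rdiv_lt_0_compat; [apply Rmult_lt_0_compat|]; lra).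
    assert (Hr : qratio q z n = e) by (unfold qratio, z; field; lra).
    specialize (Hc z hz).
    rewrite qexp_rem_prod, qexp_rem_qtail in Hc by assumption; fold c0 in Hc.
    rewrite Rpow_mult_distr, <- Rmult_assoc, (Rmult_comm c), Rmult_assoc in Hc.
    apply Rmult_le_reg_l in Hc; [|apply pow_lt; now apply qexp_term_pos].
    pose proof (qtail_le q z n hq hz ltac:(lra)) as Hu; rewrite Hr in Hu.
    pose proof (qtail_ge_1 q z n hq hz).
    pose proof (qtail_ge_1 q z (S n) hq hz).
    pose proof (qtail_ge_1 q z (S (S n)) hq hz).
    pose proof (qtail_decr q z n hq hz).
    pose proof (qtail_decr q z (S n) hq hz).
    set (F0 := qtail q z n) in *; set (F1 := qtail q z (S n)) in *.
    set (F2 := qtail q z (S (S n))) in *.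
    (* From c F1^2 <= c0 F0 F2 and F2 < F1, cancelling F1. *)
    assert (Hcmp : c * F1 <= c0 * F0).
    { apply (Rmult_le_reg_r F1); [lra|].
      apply Rle_trans with (c0 * (F0 * F2)); [lra|].
      rewrite (Rmult_assoc c0); apply Rmult_le_compat_l; [lra|].
      apply Rmult_le_compat_l; lra. }
    (* As F1 >= 1 and F0 (1 - e) <= 1, it follows that c (1 - e) <= c0, against the choice of e. *)
    nra.
Qed.
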